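(* For fixed $q \geq 3$ and for all $n > 3$, $$f(n;q,3) > 2^{n^{2 + \frac{1}{4}\left\lfloor\frac{q-3}{6}\right\rfloor - o(1)}},$$ where $o(1)$ denotes a quantity tending to $0$ as $n\to\infty$.
   Context: For integers $n > q \geq t \geq 2$, $f(n;q,t)$ denotes the maximum integer $N$ such that there is a coloring of the 3-element subsets (triples) of an $N$-element set $V$ with $q$ colors with the property that every subset of $V$ of size $n$ contains triples of at least $t$ distinct colors. *)

(* Defs.v *)
From HB Require Import structures.
From mathcomp Require Import all_boot all_order all_algebra.
From mathcomp Require Import all_classical all_reals all_analysis.

Set Implicit Arguments.
Unset Strict Implicit.
Unset Printing Implicit Defensive.

Section ErdosGyarfas.

Variables (N q : nat).

(* A coloring is a function on all subsets of V = 'I_N, but only its values on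
   the triples are ever used. *)
Definition triple_colors (c : {set 'I_N} -> 'I_q) (S : {set 'I_N}) : {set 'I_q} :=
  [set c T | T : {set 'I_N} & (T \subset S) && (#|T| == 3)]%SET.

Definition good_coloring (n t : nat) (c : {set 'I_N} -> 'I_q) : Prop :=
  forall S : {set 'I_N}, #|S| = n -> t <= #|triple_colors c S|.

End ErdosGyarfas.

Definition colorable (n q t N : nat) : Prop :=
  exists c : {set 'I_N} -> 'I_q, good_coloring n t c.

Definition is_max_colorable (n q t N : nat) : Prop :=
  colorable n q t N /\ forall M : nat, colorable n q t M -> M <= N.

(* f(n;q,t): the value is 0 if there is no maximum, so that a positive lower
   bound on f entails that the maximum exists. *)
Definition triples_f (n q t : nat) : nat := xget 0 (is_max_colorable n q t).

(* Main.v *)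
(** For [q = 3] a random colouring gives [N = 2 ^ (c n ^ 2)]. Six further colours
    gain a factor [n ^ (1/4)] in [log N]. Given a colouring [chi] of the triples of
    an [M]-set that is good for [m]-sets, view the words of length [h] over it as
    the leaves of a tree. A triple of words splits either into three branches at
    one level, and is then coloured by [chi], or at two levels [i < j], and then
    its colour records [rho {i, j}] and on which side the third word leaves at
    level [i]; here [rho] is a random 3-colouring of the pairs of levels for which
    every set of [l] levels sees all three colours, so [h] may be [2 ^ (l / 4)].

    Suppose that a set [S] of [n >= 2 ^ l], [n > l m] words sees at most two
    colours. If its tree is binary, it has a root-to-leaf path with [l] branchings.
    Otherwise a colour of [chi] occurs; hence no node has [m] children and only one
    side occurs, so that the tree is a caterpillar, whose spine has [l] branchings.
    In both cases any two of these [l] levels come from a triple in [S], so all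
    three colours of [rho] occur. *)

From mathcomp Require Import all_boot zify.
Require Import Defs.

Set Implicit Arguments.
Unset Strict Implicit.
Unset Printing Implicit Defensive.

(** * Colours seen by a set; transport of colourings *)

(** Unfolds to [triple_colors] for [k = 3] on ordinals; the case [k = 2] serves for pairs of
    levels. *)
Definition colors_on (V K : finType) (k : nat) (c : {set V} -> K) (S : {set V})
    : {set K} :=
  [set c T | T : {set V} & (T \subset S) && (#|T| == k)].

Lemma colors_onP (V K : finType) (k : nat) (c : {set V} -> K) (S : {set V}) a :
  reflect (exists T : {set V}, [/\ T \subset S, #|T| = k & c T = a])
          (a \in colors_on k c S).
Proof.
apply: (iffP imsetP) => [[T]|[T [sTS cT <-]]].
  by rewrite inE => /andP[sTS /eqP cT] ->; exists T.
by exists T => //; rewrite inE sTS cT eqxx.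
Qed.

Lemma mem_colors_on (V K : finType) (k : nat) (c : {set V} -> K)
    (S T : {set V}) :
  T \subset S -> #|T| = k -> c T \in colors_on k c S.
Proof. by move=> sTS cT; apply/colors_onP; exists T. Qed.

Lemma colors_onS (V K : finType) (k : nat) (c : {set V} -> K) (A B : {set V}) :
  A \subset B -> colors_on k c A \subset colors_on k c B.
Proof.
move=> sAB; apply/subsetP => a /colors_onP[T [sTA cT <-]].
by apply: mem_colors_on => //; apply: subset_trans sAB.
Qed.

Lemma card_subset_exists (V : finType) (S : {set V}) (n : nat) :
  n <= #|S| -> exists2 B : {set V}, B \subset S & #|B| = n.
Proof.
move=> le_n; exists [set x in take n (enum S)].
  by apply/subsetP => x; rewrite inE => /mem_take; rewrite mem_enum.
rewrite cardsE; have /card_uniqP -> := take_uniq n (enum_uniq S).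
by rewrite size_takel // -cardE.
Qed.

(** The colouring is pulled back along [e]: every triple inside [e @: S] is the image of a triple
    inside [S], so no colour is lost. *)
Lemma colorable_inj (V K : finType) (c : {set V} -> K) (n q t N : nat)
    (e : 'I_N -> V) (p : K -> 'I_q) :
  injective e -> injective p ->
  (forall S : {set V}, #|S| = n -> t <= #|colors_on 3 c S|) ->
  colorable n q t N.
Proof.
move=> inje injp good; exists (fun T : {set 'I_N} => p (c (e @: T))) => S cS.
apply: leq_trans (good (e @: S) _) _; first by rewrite card_imset.
rewrite -(card_imset _ injp); apply: subset_leq_card.
apply/subsetP => _ /imsetP[_ /colors_onP[T [sTS cT <-]] ->].
have eT : e @: [set x in S | e x \in T] = T.
  apply/setP => y; apply/imsetP/idP => [[x + ->]|yT].
    by rewrite inE => /andP[].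
  by have /imsetP[x xS ye] := subsetP sTS _ yT; exists x; rewrite // inE xS -ye.
apply/imsetP; exists [set x in S | e x \in T]; last by rewrite eT.
rewrite inE -(card_imset _ inje) eT cT eqxx andbT.
by apply/subsetP => x; rewrite inE => /andP[].
Qed.

Lemma colorable_finType (V K : finType) (c : {set V} -> K) (n t : nat) :
  (forall S : {set V}, #|S| = n -> t <= #|colors_on 3 c S|) ->
  colorable n #|K| t #|V|.
Proof. exact: (colorable_inj (@enum_val_inj _ _) (@enum_rank_inj _)). Qed.

Lemma colorable_le (n n' q q' t N N' : nat) :
  n <= n' -> q <= q' -> N' <= N -> colorable n q t N -> colorable n' q' t N'.
Proof.
move=> le_n le_q le_N [c good].
apply: (@colorable_inj _ _ c _ _ _ _ (widen_ord le_N) (widen_ord le_q)).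
- by move=> x y /(congr1 val) /= ?; apply: val_inj.
- by move=> x y /(congr1 val) /= ?; apply: val_inj.
move=> S cS; have [|B sBS cB] := @card_subset_exists _ S n; first by rewrite cS.
exact: leq_trans (good B cB) (subset_leq_card (colors_onS _ _ sBS)).
Qed.

(** * Random 3-colourings *)

Lemma card_bigcup_leq (I T : finType) (P : pred I) (F : I -> {set T}) :
  #|\bigcup_(i | P i) F i| <= \sum_(i | P i) #|F i|.
Proof.
elim/big_rec2: _ => [|i m A _ le_A]; first by rewrite cards0.
by apply: leq_trans (leq_card_setU _ _) _; rewrite leq_add2l.
Qed.

Lemma bin_leq_exp (n m : nat) : 'C(n, m) <= n ^ m.
Proof.
apply: (@leq_trans (n ^_ m)); first by rewrite -bin_ffact leq_pmulr ?fact_gt0.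
rewrite ffact_prod -[m in leqRHS]card_ord -prod_nat_const.
by apply: leq_prod => i _; rewrite leq_subr.
Qed.

(** These colourings form a product: two values on each [k]-subset of [S], three on every other set.
    The probability of avoiding [a] is thus [(2/3) ^ 'C(#|S|, k)]. *)
Lemma card_avoiding_colorings (V : finType) (k : nat) (S : {set V}) (a : 'I_3) :
  #|[set c : {ffun {set V} -> 'I_3} | a \notin colors_on k c S]|
    * 3 ^ 'C(#|S|, k) = 2 ^ 'C(#|S|, k) * 3 ^ #|{set V}|.
Proof.
pose D := [set T : {set V} | T \subset S & #|T| == k].
pose F (T : {set V}) : pred 'I_3 := if T \in D then predC1 a else predT.
have -> : [set c : {ffun {set V} -> 'I_3} | a \notin colors_on k c S]
          = [set c in family F].
  apply/setP => c; rewrite !inE; apply/idP/familyP => [ac T|Fc].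
    rewrite /F; case: ifP => // TD; rewrite !inE; apply: contra ac => /eqP <-.
    by move: TD; rewrite inE => /andP[sT /eqP cT]; apply: mem_colors_on.
  apply/negP => /colors_onP[T [sT cT cTa]].
  by have := Fc T; rewrite /F inE sT cT eqxx !inE cTa eqxx.
rewrite cardsE card_family foldrE big_map big_enum /= (bigID (mem D)) /=.
have -> : \prod_(T in D) #|F T| = 2 ^ 'C(#|S|, k).
  rewrite -cards_draws -prod_nat_const; apply: eq_bigr => T TD.
  by rewrite /F TD cardC1 card_ord.
have -> : \prod_(T | T \notin D) #|F T| = 3 ^ #|[predC D]|.
  rewrite -prod_nat_const; apply: eq_bigr => T TD.
  by rewrite /F (negbTE TD) cardT -cardE card_ord.
by rewrite -mulnA -expnD addnC -[in 'C(_, _)]cards_draws cardC.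
Qed.

(* A uniformly random 3-colouring works with positive probability. *)
Lemma exists_tricoloring (N n k : nat) :
  3 * N ^ n * 2 ^ 'C(n, k) < 3 ^ 'C(n, k) ->
  exists c : {set 'I_N} -> 'I_3,
    forall S : {set 'I_N}, #|S| = n -> colors_on k c S = setT.
Proof.
move=> lt3; set b := 'C(n, k) in lt3.
pose bad (p : {set 'I_N} * 'I_3) :=
  [set c : {ffun {set 'I_N} -> 'I_3} | p.2 \notin colors_on k c p.1].
pose I := [set p : {set 'I_N} * 'I_3 | #|p.1| == n].
have cI : #|I| <= 3 * N ^ n.
  have -> : I = setX [set A : {set 'I_N} | #|A| == n] setT.
    by apply/setP => p; rewrite !inE andbT.
  by rewrite cardsX card_draws cardsT !card_ord mulnC leq_mul2l bin_leq_exp.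
(* Union bound: the bad events, one for each [n]-set and each missing colour, do not cover all
   colourings. *)
have lt_bad : #|\bigcup_(p in I) bad p| < 3 ^ #|{set 'I_N}|.
  rewrite -(ltn_pmul2r (expn_gt0 3 b)); apply: leq_ltn_trans.
    by apply: leq_mul (card_bigcup_leq _ _) (leqnn _).
  rewrite big_distrl /= (eq_bigr (fun=> 2 ^ b * 3 ^ #|{set 'I_N}|)); last first.
    by move=> p; rewrite inE => /eqP cp; rewrite /b -cp card_avoiding_colorings.
  rewrite sum_nat_const mulnA mulnC ltn_pmul2l ?expn_gt0 //.
  by apply: leq_ltn_trans lt3; rewrite leq_mul2r cI orbT.
have [c] : exists c, c \notin \bigcup_(p in I) bad p.
  apply/existsP; rewrite -negb_forall; apply: contraL lt_bad => /forallP all_bad.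
  rewrite -leqNgt -[X in X ^ _](card_ord 3) -card_ffun -cardsT subset_leq_card //.
  by apply/subsetP => c _.
move=> /bigcupP c_good; exists c => S cS; apply/setP => a; rewrite inE.
apply: contraPT c_good => aS; apply; exists (S, a); rewrite inE //=.
by rewrite cS eqxx.
Qed.

(** * Ramsey's theorem and existence of the maximum *)

(* Ramsey's theorem for k-subsets. The inductive step allows a separate target
   size for each colour, and descends on the sum of the targets. *)
Lemma ramsey_subseq (q k n : nat) :
  exists N, forall (T : eqType) (c : seq T -> 'I_q) (s : seq T), N <= size s ->
    exists (t : seq T) (a : 'I_q), [/\ subseq t s, size t = n
      & forall u, subseq u t -> size u = k -> c u = a].
Proof.
elim: k n => [|k IHk] n.
  exists n => T c s le_n; exists (take n s), (c [::]).
  rewrite take_subseq size_takel //; split=> // u _ /size0nil -> //.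
have multi p (nu : 'I_q -> nat) : \sum_i nu i = p ->
  exists N, forall (T : eqType) (c : seq T -> 'I_q) (s : seq T), N <= size s ->
    exists (t : seq T) (a : 'I_q), [/\ subseq t s, size t = nu a
      & forall u, subseq u t -> size u = k.+1 -> c u = a].
  elim: p nu => [|p IHp] nu sum_nu.
    exists 0 => T c s _; exists [::], (c [::]); rewrite sub0seq; split=> //.
      by have /eqP := sum_nu; rewrite sum_nat_eq0 => /forallP/(_ (c [::]))/eqP ->.
    by move=> u; rewrite subseq0 => /eqP ->.
  case: (boolP [exists a, nu a == 0]) => [/existsP[a /eqP nu_a]|].
    exists 0 => T c s _; exists [::], a; rewrite sub0seq nu_a; split=> //.
    by move=> u; rewrite subseq0 => /eqP ->.
  rewrite negb_exists => /forallP nu_gt0.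
  have /fin_all_exists[Nf HNf] : forall a : 'I_q, exists N,
      forall (T : eqType) (c : seq T -> 'I_q) (s : seq T), N <= size s ->
      exists (t : seq T) (b : 'I_q),
        [/\ subseq t s, size t = nu b - (b == a)
          & forall u, subseq u t -> size u = k.+1 -> c u = b].
    move=> a; apply: IHp; move: sum_nu.
    rewrite (bigD1 a) //= [in X in _ -> X](bigD1 a) //= eqxx.
    under [in X in _ -> X]eq_bigr => b /negbTE -> do rewrite subn0.
    by have := nu_gt0 a; lia.
  (* First the colour of [x :: u] is made constant, equal to [a], for [u] in [s1]. Then [x] extends
     a homogeneous [t] of colour [a], which makes up for the lowered target. *)
  have [N HN] := IHk (\max_a Nf a); exists N.+1 => T c [|x s] //= le_N.
  have [s1 [a [ss1 sz1 c1]]] := HN T (fun u => c (x :: u)) s le_N.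
  have [|t [b [sst szt ct]]] := HNf a T c s1; first by rewrite sz1 leq_bigmax.
  have sub_s := subseq_trans sst ss1.
  move: szt; have [eq_ba|ne_ba] := eqVneq b a => szt; last first.
    exists t, b; split=> //; first exact: subseq_trans sub_s (subseq_cons _ _).
    by rewrite szt subn0.
  exists (x :: t), b; split=> /=; first by rewrite eqxx.
    by rewrite szt; have := nu_gt0 b; lia.
  case=> [//|y u]; rewrite /=; case: eqVneq => [->|_] sub_u szu.
    by rewrite eq_ba; apply: c1; [apply: subseq_trans sst|case: szu].
  exact: ct.
have [N HN] := multi _ (fun=> n) erefl; exists N => T c s /(HN T c s).
by case=> t [a Ht]; exists t, a.
Qed.

(** On too many points, Ramsey's theorem yields an [n]-set with triples of one colour only. Hence
    the maximum in [triples_f] exists. *)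
Lemma colorable_bounded (n q t : nat) : 1 < t ->
  exists B, forall N, colorable n q t N -> N <= B.
Proof.
move=> t_gt1; have [B HB] := ramsey_subseq q 3 n; exists B => N [c good].
rewrite leqNgt; apply/negP => lt_BN.
have [|s [a [sub_s sz_s cs]]] :=
    HB _ (fun u : seq 'I_N => c [set x in u]) (enum 'I_N).
  by rewrite size_enum_ord ltnW.
have uniq_s : uniq s := subseq_uniq sub_s (enum_uniq _).
have card_s : #|[set x in s]| = n by rewrite cardsE (card_uniqP uniq_s).
have := good _ card_s.
suff : triple_colors c [set x in s] \subset [set a].
  by move=> /subset_leq_card; rewrite cards1; lia.
apply/subsetP => _ /colors_onP[T [sT cT <-]]; rewrite inE; apply/eqP.
have eT : T = [set x in [seq y <- s | y \in T]].
  apply/setP => x; rewrite inE mem_filter; case: (boolP (x \in T)) => //= xT.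
  by have := subsetP sT _ xT; rewrite inE => ->.
rewrite eT; apply: cs; first exact: filter_subseq.
by rewrite -cT [in RHS]eT cardsE; apply/esym/card_uniqP/filter_uniq.
Qed.

(** * Random colourings of pairs of levels and of triples *)

(* From [2 ^ 11 <= 3 ^ 7]. *)
Lemma exp3_gt (x y b : nat) :
  7 * y <= b -> x + 2 <= 4 * y -> 3 * 2 ^ x * 2 ^ b < 3 ^ b.
Proof.
move=> le_b le_x; have eb : b = 7 * y + (b - 7 * y) by lia.
rewrite {}eb; move: (b - 7 * y) => d.
rewrite (expnD 2 (7 * y)) (expnD 3 (7 * y)) mulnA.
have lt1 : 3 * 2 ^ x * 2 ^ (7 * y) < 3 ^ (7 * y).
  (* The factor [2 ^ (4 * y - x)], at least 4, absorbs the 3. *)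
  apply: (@leq_trans (2 ^ (11 * y))); last by rewrite !expnM leq_exp2r //; lia.
  have -> : 11 * y = (4 * y - x) + x + 7 * y by lia.
  rewrite (expnD 2 _ (7 * y)) (expnD 2 _ x) !ltn_pmul2r ?expn_gt0 //.
  by apply: (@leq_trans (2 ^ 2)) => //; rewrite leq_pexp2l //; lia.
apply: (@leq_trans (3 ^ (7 * y) * 2 ^ d)); first by rewrite ltn_pmul2r ?expn_gt0.
rewrite leq_pmul2l ?expn_gt0 //.
by case: d => // d; rewrite leq_exp2r.
Qed.

Lemma exists_pair_tricoloring (w : nat) : 4 <= w ->
  exists rho : {set 'I_(2 ^ w)} -> 'I_3,
    forall L : {set 'I_(2 ^ w)}, #|L| = 4 * w -> colors_on 2 rho L = setT.
Proof.
move=> le_w; apply: exists_tricoloring; rewrite -expnM.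
(* The binomial is [8 * w ^ 2 - 2 * w], so the bound amounts to [2 * w + 7 <= w ^ 2], true from
   [w = 4] on. *)
apply: (@exp3_gt _ (w * w + 1)); last by nia.
have := bin_ffact (4 * w) 2; rewrite !ffactnS ffactn0 muln1 (_ : 2`! = 2) //.
have [v ->] : exists v, w = v + 4 by exists (w - 4); lia.
have -> : (4 * (v + 4)).-1 = 4 * v + 15 by lia.
by set b := 'C(_, _); nia.
Qed.

Lemma colorable_base (s : nat) : 4 <= s ->
  colorable (2 ^ s) 3 3 (2 ^ 2 ^ (2 * s - 6)).
Proof.
move=> le_s; set n := 2 ^ s; set g := 2 ^ (2 * s - 6).
have n_ge : 16 <= n by rewrite -[16]/(2 ^ 4) leq_pexp2l.
have en : 64 * g = n * n.
  by rewrite -expnD -[64]/(2 ^ 6) -expnD; congr (2 ^ _); lia.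
have [m em] : exists m, n = 2 * m.
  by exists (2 ^ s.-1); rewrite -expnS prednK //; lia.
have [|c Hc] := @exists_tricoloring (2 ^ g) n 3.
  (* Since [g = n ^ 2 / 64], [7 * (g * m)] is [7 * n ^ 3 / 128], below ['C(n, 3)] for [n >= 16]. *)
  rewrite -expnM; apply: (@exp3_gt _ (g * m)); last by nia.
  have e3 : 6 * 'C(n, 3) = n * (n - 1) * (n - 2).
    by have := bin_ffact n 3; rewrite !ffactnS ffactn0 muln1 (_ : 3`! = 6) //; lia.
  by nia.
exists c => S /Hc cS; have -> : triple_colors c S = setT := cS.
by rewrite cardsT card_ord.
Qed.

(** * Words as leaves of a tree, and their colouring *)

Section Step.

Variables (h M q : nat).
Notation word := {ffun 'I_h -> 'I_M}.
Implicit Types (x y z : word) (i j : 'I_h) (S T : {set word}).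

Definition agree_before x y i := [forall l : 'I_h, (l < i) ==> (x l == y l)].

(** The depth of the last common node of the two leaves. *)
Definition split_at x y i := agree_before x y i && (x i != y i).

Definition level_image i S : {set 'I_M} := [set (x : word) i | x in S].

Lemma mem_level_image S i x : x \in S -> x i \in level_image i S.
Proof. by move=> xS; apply/imsetP; exists x. Qed.

Lemma split_atP x y i :
  reflect ((forall l : 'I_h, l < i -> x l = y l) /\ x i <> y i) (split_at x y i).
Proof.
apply: (iffP andP) => [[/forallP xy /eqP ne]|[xy /eqP ne]]; split=> //.
  by move=> l li; apply/eqP/(implyP (xy l)).
by apply/forallP => l; apply/implyP => li; rewrite xy.
Qed.

Lemma split_at_sym x y i : split_at x y i = split_at y x i.
Proof.
by rewrite /split_at eq_sym; congr (_ && _); apply: eq_forallb => l; rewrite eq_sym.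
Qed.

Lemma split_at_inj x y i j : split_at x y i -> split_at x y j -> i = j.
Proof.
move=> /split_atP[eqi nei] /split_atP[eqj nej]; apply: val_inj => /=.
by case: (ltngtP i j) => // lt_ij; [have := eqj _ lt_ij|have := eqi _ lt_ij].
Qed.

Lemma split_at_neq x y i : split_at x y i -> x != y.
Proof. by move=> /split_atP[_ ne]; apply: contra_not_neq ne => ->. Qed.

Lemma split_at_irr x i : split_at x x i = false.
Proof. by rewrite /split_at eqxx andbF. Qed.

Lemma neq_split_at x y : x != y -> exists i, split_at x y i.
Proof.
move=> ne; have [i0 ne0] : exists i, x i != y i.
  apply/existsP; rewrite -negb_forall; apply: contra ne => /forallP e.
  by apply/eqP/ffunP => i; apply/eqP.
case: (@arg_minnP _ i0 (fun i => x i != y i) val ne0) => i nei mini.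
exists i; apply/split_atP; split; last exact/eqP.
by move=> l li; apply/eqP; apply: contraLR li => /mini; rewrite -leqNgt.
Qed.

Lemma split_at_trans x y z i j :
  split_at x y j -> split_at x z i -> i < j -> split_at y z i.
Proof.
move=> /split_atP[xy _] /split_atP[xz nxz] lt_ij; apply/split_atP.
split=> [l li|]; last by rewrite -xy.
by rewrite -xz // -xy //; apply: ltn_trans lt_ij.
Qed.

Variables (chi : {set 'I_M} -> 'I_q) (rho : {set 'I_h} -> 'I_3).

Definition cherry T (p : word * word * word * ('I_h * 'I_h)) :=
  let: (x, y, z, (i, j)) := p in
  [&& T == [set x; y; z], split_at x y j, split_at x z i & i < j].

(* The last value is not taken on triples: if no two words of a triple split later
   than a third one leaves, all three split at the same level. *)
Definition word_color T : 'I_q + bool * 'I_3 :=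
  if [pick p | cherry T p] is Some (x, y, z, (i, j))
  then inr ((x i : nat) < z i, rho [set i; j])
  else if [pick i | [forall x in T, forall y in T, (x != y) ==> split_at x y i]]
    is Some i then inl (chi (level_image i T))
  else inr (true, ord0).

(** The pair that splits last is determined by the triple, so the choice can only exchange [x] and
    [y]; these agree at level [i], and the colour is the same. *)
Lemma word_color_cherry x y z i j :
  split_at x y j -> split_at x z i -> i < j ->
  word_color [set x; y; z] = inr ((x i : nat) < z i, rho [set i; j]).
Proof.
move=> xyj xzi ij; have yzi := split_at_trans xyj xzi ij.
rewrite /word_color; case: pickP => [[[[x' y'] z'] [i' j']]|]; last first.
  by move/(_ (x, y, z, (i, j))); rewrite /= eqxx xyj xzi ij.
move=> /and4P[/eqP eT xyj' xzi' ij'].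
have /setP/(_ x') := eT; rewrite !inE eqxx ?orbT /= => Hx.
have /setP/(_ y') := eT; rewrite !inE eqxx ?orbT /= => Hy.
have /setP/(_ z') := eT; rewrite !inE eqxx ?orbT /= => Hz.
have yx := xyj; rewrite split_at_sym in yx.
have zx := xzi; rewrite split_at_sym in zx.
have zy := yzi; rewrite split_at_sym in zy.
have exy : x i = y i by have /split_atP[+ _] := xyj; apply.
have fin : i' = i -> j' = j -> x' i = x i -> z' = z ->
   inr ((x' i' : nat) < z' i', rho [set i'; j'])
   = inr ((x i : nat) < z i, rho [set i; j]) :> 'I_q + bool * 'I_3.
  by move=> -> -> -> ->.
(* Of the 27 assignments of [x'], [y'], [z'], only the identity and the exchange of [x] and [y]
   survive. *)
case/orP: Hx => [/orP[]|] /eqP ?; case/orP: Hy => [/orP[]|] /eqP ?;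
  case/orP: Hz => [/orP[]|] /eqP ?; subst x' y' z';
  rewrite ?split_at_irr // in xyj' xzi'.
all: repeat match goal with
  | A : is_true (split_at ?a ?b ?k), B : is_true (split_at ?a ?b ?k') |- _ =>
     assert_fails (constr_eq k k'); have ? := split_at_inj A B; clear B
  end.
all: try (by subst; lia).
all: by apply: fin.
Qed.

(** A cherry would have both its levels equal to [i]; and two distinct words in [T] determine
    [i]. *)
Lemma word_color_star T i : 1 < #|T| ->
  {in T &, forall x y, x != y -> split_at x y i} ->
  word_color T = inl (chi (level_image i T)).
Proof.
move=> /card_gt1P[u [v [uT vT ne_uv]]] star.
rewrite /word_color; case: pickP => [[[[x y] z] [i' j']]|_].
  move=> /and4P[/eqP eT xyj xzi ij].
  have [xT yT zT] : [/\ x \in T, y \in T & z \in T].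
    by rewrite eT !inE !eqxx !orbT.
  have ? := split_at_inj xyj (star _ _ xT yT (split_at_neq xyj)).
  have ? := split_at_inj xzi (star _ _ xT zT (split_at_neq xzi)).
  by subst; rewrite ltnn in ij.
case: pickP => [i'|/(_ i)/negP[]].
  move=> /forall_inP/(_ _ uT)/forall_inP/(_ _ vT)/implyP/(_ ne_uv) uvi.
  by rewrite (split_at_inj uvi (star _ _ uT vT ne_uv)).
apply/forall_inP => x xT; apply/forall_inP => y yT; apply/implyP.
exact: star.
Qed.

(** * Branchings of a set of words *)

Definition fiber S i v : {set word} := [set x in S | x i == v].

(** [S] lies below a single node of depth [i]; the nonempty sets [fiber S i v] are then the subtrees
    at its children. *)
Definition agree_on S i := {in S &, forall x y, agree_before x y i}.

Lemma exists_branching S : 1 < #|S| -> exists i,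
  agree_on S i /\ 1 < #|level_image i S|.
Proof.
move=> /card_gt1P[u [v [uS vS ne_uv]]].
have [i0 uv0] := neq_split_at ne_uv.
pose P i := [exists x in S, exists y in S, x i != y i].
have P0 : P i0.
  apply/exists_inP; exists u => //; apply/exists_inP; exists v => //.
  by case/andP: uv0.
case: (@arg_minnP _ i0 P val P0) => i Pi mini; exists i; split.
  move=> x y xS yS; apply/forallP => l; apply/implyP => li.
  apply: contraLR li => ne; rewrite -leqNgt; apply: mini.
  by apply/exists_inP; exists x => //; apply/exists_inP; exists y.
have /exists_inP[x xS /exists_inP[y yS ne]] := Pi.
by apply/card_gt1P; exists (x i), (y i); split; rewrite ?mem_level_image.
Qed.

(** [B k] words guarantee a path with [k] branchings: the descent continues in a child that keeps
    [B k] of [B k.+1] words. A pair splitting at [j] inside that child, with a word leaving at [i],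
    realises the levels [i < j]. *)
Lemma chain_of_levels (B : nat -> nat) (S0 : {set word}) :
  (forall k, 1 < B k.+1) ->
  (forall S i k, S \subset S0 -> agree_on S i -> 1 < #|level_image i S| ->
    B k.+1 <= #|S| -> exists v, B k <= #|fiber S i v|) ->
  forall k S, S \subset S0 -> B k <= #|S| -> exists L : {set 'I_h},
    [/\ #|L| = k,
        {in L, forall j, exists x y, [/\ x \in S, y \in S & split_at x y j]}
      & {in L &, forall i j, i < j -> exists x y z,
          [/\ x \in S, y \in S, z \in S, split_at x y j & split_at x z i]}].
Proof.
move=> B_gt1 Bstep; elim=> [|k IHk] S sS BS.
  by exists set0; rewrite cards0; split=> // i; rewrite inE.
have [i [ag im]] := exists_branching (leq_trans (B_gt1 k) BS).
have [v Bv] := Bstep S i k sS ag im BS.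
have sF : fiber S i v \subset S by apply/subsetP => x; rewrite inE => /andP[].
have [L [cL Lspl Lch]] := IHk _ (subset_trans sF sS) Bv.
have ltL j : j \in L -> i < j.
  move=> /Lspl[x [y []]]; rewrite !inE => /andP[xS /eqP xv] /andP[yS /eqP yv].
  move=> /split_atP[_ ne]; rewrite ltnNge leq_eqVlt.
  apply/negP => /orP[/eqP/val_inj ji|ji].
    by apply: ne; rewrite ji xv yv.
  by apply: ne; have /forallP/(_ j)/implyP/(_ ji)/eqP := ag _ _ xS yS.
have [z zS zv] : exists2 z, z \in S & z i != v.
  have /card_gt1P[a [b [/imsetP[x xS xa] /imsetP[y yS yb] ab]]] := im.
  have [av|] := eqVneq a v; last by exists x; rewrite // -xa.
  by exists y; rewrite // -yb -av eq_sym.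
have splz x : x \in fiber S i v -> split_at x z i.
  rewrite inE => /andP[xS /eqP xv]; rewrite /split_at ag //= xv eq_sym //.
have iL : i \notin L by apply/negP => /ltL; rewrite ltnn.
have Lspl' j : j \in L -> exists x y,
    [/\ x \in fiber S i v, x \in S, y \in S & split_at x y j].
  by move=> /Lspl[x [y [xF yF xy]]]; exists x, y; split=> //; apply: (subsetP sF).
exists (i |: L); split; first by rewrite cardsU1 iL cL.
- move=> j; rewrite !inE => /predU1P[->|/Lspl'[x [y [_ xS yS xy]]]]; last first.
    by exists x, y.
  (* [B 0] may be 0, so the fibre can be empty; then two words with different labels at [i]
     serve. *)
  case: (posnP #|fiber S i v|) => [F0|/card_gt0P[x xF]]; last first.
    by exists x, z; split; rewrite ?splz // (subsetP sF).
  have /card_gt1P[_ [_ [/imsetP[x xS ->] /imsetP[y yS ->] ne]]] := im.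
  by exists x, y; split=> //; rewrite /split_at ag.
move=> a b; rewrite !inE => /predU1P[->|aL] /predU1P[->|bL]; rewrite ?ltnn //.
- move=> _; have [x [y [xF xS yS xy]]] := Lspl' b bL.
  by exists x, y, z; split; rewrite ?splz.
- by move=> ab; have := ltL a aL; rewrite ltnNge ltnW.
move=> /(Lch _ _ aL bL)[x [y [w [xF yF wF xy xw]]]]; exists x, y, w.
by split=> //; apply: (subsetP sF).
Qed.

(** * Colours forced by a branching *)

(** One word through each branch in [A] gives three words that split pairwise at level [i]. *)
Lemma star_color S i (A : {set 'I_M}) :
  agree_on S i -> A \subset level_image i S -> #|A| = 3 ->
  inl (chi A) \in colors_on 3 word_color S.
Proof.
move=> ag sA cA.
have [x0 x0S] : exists x, x \in S.
  have /card_gt0P[v vA] : 0 < #|A| by rewrite cA.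
  by have /imsetP[x xS _] := subsetP sA _ vA; exists x.
have /fin_all_exists[f Hf] (v : 'I_M) :
    exists x, x \in S /\ (v \in A -> x i = v).
  case: (boolP (v \in A)) => [vA|_]; last by exists x0.
  by have /imsetP[x xS ->] := subsetP sA _ vA; exists x.
have injf : {in A &, injective f}.
  by move=> v w vA wA e; rewrite -(proj2 (Hf v) vA) -(proj2 (Hf w) wA) e.
have cT : #|f @: A| = 3 by rewrite card_in_imset.
have eA : level_image i (f @: A) = A.
  rewrite /level_image -imset_comp -[RHS]imset_id; apply: eq_in_imset => v vA /=.
  by have [_ ->] := Hf v.
rewrite -[in chi A]eA -word_color_star ?cT //.
  by apply: mem_colors_on cT; apply/subsetP => _ /imsetP[v _ ->]; have [] := Hf v.
move=> _ _ /imsetP[v vA ->] /imsetP[w wA ->] ne.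
rewrite /split_at ag ?(proj1 (Hf _)) //=.
by rewrite (proj2 (Hf v)) // (proj2 (Hf w)) //; apply: contra_neq ne => ->.
Qed.

(** A node with [m] children carries a copy of [chi] on an [m]-set. *)
Lemma wide_branching S i m : good_coloring m 3 chi -> agree_on S i ->
  m <= #|level_image i S| -> 3 <= #|colors_on 3 word_color S|.
Proof.
move=> good ag /card_subset_exists[A sA cA].
apply: leq_trans (good A cA) _.
rewrite -(card_imset _ (inl_inj : injective (@inl _ (bool * 'I_3)))).
apply/subset_leq_card/subsetP => _ /imsetP[_ /colors_onP[T [sT cT <-]] ->].
by apply: star_color ag _ cT; apply: subset_trans sA.
Qed.

(** Two words through [v] split later than level [i], so they form a cherry with [z]. *)
Lemma cherry_color S i v z : agree_on S i -> 1 < #|fiber S i v| ->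
  z \in S -> z i != v ->
  exists a, inr (v < z i, a) \in colors_on 3 word_color S.
Proof.
move=> ag /card_gt1P[x [y []]]; rewrite !inE => /andP[xS /eqP xv] /andP[yS /eqP yv].
move=> ne zS zv; have [j xyj] := neq_split_at ne.
have xzi : split_at x z i by rewrite /split_at ag //= xv eq_sym.
have yzi : split_at y z i by rewrite /split_at ag //= yv eq_sym.
have ij : i < j.
  move: xyj => /split_atP[_ nej]; rewrite ltnNge leq_eqVlt.
  apply/negP => /orP[/eqP/val_inj ji|ji]; apply: nej; first by rewrite ji xv yv.
  by have /forallP/(_ j)/implyP/(_ ji)/eqP := ag _ _ xS yS.
exists (rho [set i; j]); rewrite -xv -(word_color_cherry xyj xzi ij).
apply: mem_colors_on; first by rewrite !subUset !sub1set xS yS zS.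
have nzx := split_at_neq xzi; have nzy := split_at_neq yzi.
by rewrite -setUA cardsU1 cards2 !inE negb_or ne nzx nzy.
Qed.

Lemma card_fiber_sum S i : #|S| = \sum_(v in level_image i S) #|fiber S i v|.
Proof.
rewrite -sum1_card (partition_big (fun x : word => x i) (mem (level_image i S))) /=.
  by apply: eq_bigr => v _; rewrite sum1dep_card cardsE.
by move=> x; apply: mem_level_image.
Qed.

Lemma binary_branching S i k : #|level_image i S| <= 2 -> 2 ^ k.+1 <= #|S| ->
  exists v, 2 ^ k <= #|fiber S i v|.
Proof.
move=> im2 S2; apply/existsP; apply: contraLR S2; rewrite negb_exists -ltnNge.
move=> /forallP small; rewrite (card_fiber_sum S i).
apply: (@leq_ltn_trans (\sum_(v in level_image i S) (2 ^ k).-1)).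
  by apply: leq_sum => v _; have := small v; rewrite -ltnNge; lia.
rewrite sum_nat_const expnS; have : 0 < 2 ^ k by rewrite expn_gt0.
by move: (2 ^ k) im2; nia.
Qed.

(** All children but one hold at most one word, so fewer than [m] words leave the spine here. *)
Lemma caterpillar_branching S i m k : #|level_image i S| < m ->
  (forall v w, 1 < #|fiber S i v| -> 1 < #|fiber S i w| -> v = w) ->
  k.+1 * m < #|S| -> exists v, k * m < #|fiber S i v|.
Proof.
move=> im_m uniqv bigS.
have inj_out (A : {set word}) : A \subset S ->
    {in A, forall x, #|fiber S i (x i)| <= 1} -> #|A| < m.
  move=> /subsetP sA smallA; apply: leq_ltn_trans im_m.
  rewrite -(card_in_imset (f := fun x : word => x i) (D := A)).
    apply/subset_leq_card/subsetP => _ /imsetP[x /sA xS ->].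
    exact: mem_level_image.
  move=> x y xA yA e; apply/eqP; apply: contraT => ne.
  have := smallA x xA; rewrite leqNgt; case/negP; apply/card_gt1P.
  by exists x, y; rewrite !inE -e eqxx !sA.
have [v bigv] : exists v, 1 < #|fiber S i v|.
  apply/existsP; apply: contraT; rewrite negb_exists => /forallP small.
  suff : #|S| < m by lia.
  by apply: inj_out => // x _; have := small (x i); rewrite -leqNgt.
exists v; have : #|S :\: fiber S i v| < m.
  apply: inj_out; first exact: subsetDl.
  move=> x; rewrite !inE => /andP[+ xS]; rewrite xS /= => ne; rewrite leqNgt.
  by apply: contra ne => /(uniqv _ _ bigv) <-.
have := cardsID (fiber S i v) S; rewrite (setIidPr _); last first.
  by apply/subsetP => x; rewrite inE => /andP[].
by lia.
Qed.

Lemma word_color_good m l n :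
  good_coloring m 3 chi ->
  (forall L : {set 'I_h}, #|L| = l -> colors_on 2 rho L = setT) ->
  l * m < n -> 2 ^ l <= n ->
  forall S : {set word}, #|S| = n -> 3 <= #|colors_on 3 word_color S|.
Proof.
move=> good full lm_n l2_n S0 cS0; set C := colors_on 3 word_color S0.
rewrite leqNgt; apply/negP => C_lt3.
(* The empty set sees no colour, so [m] is not 0; this gives [1 < k.+1 * m + 1] below. *)
have m_gt0 : 0 < m.
  case: m good {lm_n} => // /(_ set0 (cards0 _)).
  rewrite leqNgt => /negP[]; apply: (@leq_ltn_trans 0) => //.
  rewrite leqn0 cards_eq0; apply/eqP/setP => a; rewrite [RHS]inE.
  apply/negbTE/negP => /colors_onP[T [+ + _]].
  by rewrite subset0 => /eqP ->; rewrite cards0.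
have subC (S : {set word}) : S \subset S0 -> colors_on 3 word_color S \subset C.
  exact: colors_onS.
(* On [l] levels any two of which come from a triple, the three values of [rho] already give three
   colours. *)
suff [L [cL _ Lch]] : exists L : {set 'I_h},
    [/\ #|L| = l,
        {in L, forall j, exists x y, [/\ x \in S0, y \in S0 & split_at x y j]}
      & {in L &, forall i j, i < j -> exists x y z,
          [/\ x \in S0, y \in S0, z \in S0, split_at x y j & split_at x z i]}].
  have /fin_all_exists[e He] (a : 'I_3) : exists e, inr (e, a) \in C.
    have : a \in colors_on 2 rho L by rewrite full // inE.
    case/colors_onP => P [sP /eqP/cards2P[i [j [ne_ij eP]]] <-].
    wlog ij : i j ne_ij eP / i < j.
      move=> Hw; have [ij|ji|/val_inj eij] := ltngtP i j.
      - exact: Hw ne_ij eP ij.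
      - by apply: (Hw j i) => //; rewrite 1?eq_sym // setUC.
      - by rewrite eij eqxx in ne_ij.
    have [iL jL] : i \in L /\ j \in L.
      by split; apply: (subsetP sP); rewrite eP !inE eqxx ?orbT.
    have [x [y [z [xS yS zS xyj xzi]]]] := Lch i j iL jL ij.
    exists ((x i : nat) < z i); rewrite eP -(word_color_cherry xyj xzi ij).
    apply: mem_colors_on; first by rewrite !subUset !sub1set xS yS zS.
    have yzi := split_at_trans xyj xzi ij.
    rewrite -setUA cardsU1 cards2 !inE negb_or.
    by rewrite !(split_at_neq xyj, split_at_neq xzi, split_at_neq yzi).
  have inj_e : injective (fun a => inr (e a, a) : 'I_q + bool * 'I_3).
    by move=> a b [].
  move: C_lt3; rewrite ltnNge => /negP[].
  rewrite -[X in X <= _](card_ord 3) -(card_imset _ inj_e).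
  by apply/subset_leq_card/subsetP => _ /imsetP[a _ ->].
(* If a colour of [chi] occurs, the tree is a caterpillar; otherwise it is binary. *)
have [/existsP[c0 c0C]|noinl] := boolP [exists c0, inl c0 \in C].
  apply: (@chain_of_levels (fun k => k * m + 1) S0) => //; last by rewrite cS0 addn1.
    by move=> k; rewrite mulSn; lia.
  move=> S i k sS ag im; rewrite addn1 => bigS.
  have im_m : #|level_image i S| < m.
    rewrite ltnNge; apply: contraL C_lt3 => /(wide_branching good ag) le3.
    by rewrite -leqNgt; apply: leq_trans le3 (subset_leq_card (subC _ sS)).
  have [|v bigv] := caterpillar_branching im_m _ bigS; last first.
    by exists v; rewrite addn1.
  (* Two children with two words each would give cherries left on opposite sides, hence two colours
     besides [inl c0]. *)
  move=> v w bigv bigw; apply/eqP; apply: contraLR C_lt3 => ne_vw.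
  have lt v' w' : 1 < #|fiber S i v'| -> 1 < #|fiber S i w'| -> v' != w' ->
      exists a, inr ((v' : nat) < w', a) \in C.
    move=> bigv' /ltnW/card_gt0P[z]; rewrite inE => /andP[zS /eqP zw] ne.
    have [|a aC] := cherry_color ag bigv' zS; first by rewrite zw eq_sym.
    by exists a; rewrite -zw (subsetP (subC _ sS)).
  have [a aC] := lt v w bigv bigw ne_vw.
  have [|b bC] := lt w v bigw bigv; first by rewrite eq_sym.
  rewrite -leqNgt; apply/card_gt2P.
  exists (inl c0), (inr ((v : nat) < w, a)), (inr ((w : nat) < v, b)).
  split=> //; split=> //.
  apply/eqP => -[+ _]; move: ne_vw; rewrite -val_eqE /=; lia.
apply: (@chain_of_levels (fun k => 2 ^ k) S0) => //; last by rewrite cS0.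
  by move=> k; rewrite -[1]/(2 ^ 0) ltn_exp2l.
move=> S i k sS ag im; apply: binary_branching; rewrite leqNgt.
apply: contra noinl => /card_subset_exists[A sA cA]; apply/existsP; exists (chi A).
by apply: (subsetP (subC _ sS)); apply: star_color ag sA cA.
Qed.

End Step.

(** * Iteration of the step *)

Lemma colorable_step (h M q m l n : nat) (rho : {set 'I_h} -> 'I_3) :
  colorable m q 3 M ->
  (forall L : {set 'I_h}, #|L| = l -> colors_on 2 rho L = setT) ->
  l * m < n -> 2 ^ l <= n -> colorable n (q + 6) 3 (M ^ h).
Proof.
move=> [chi good] full lm_n l2_n.
have := colorable_finType (word_color_good good full lm_n l2_n).
by rewrite card_ffun card_sum card_prod !card_ord card_bool.
Qed.

Lemma leq_double_exp2 (x : nat) : 2 * x <= 2 ^ x.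
Proof. by case: x => // x; rewrite expnS leq_mul2l /= ltn_expl. Qed.

Lemma leq_exp_base (a b e : nat) : a <= b -> a ^ e <= b ^ e.
Proof. by case: e => // e le_ab; rewrite leq_exp2r. Qed.

(* With [n = 2 ^ s] and [N = 2 ^ g] this is [log2 N >= n ^ (2 + k / 4)], up to a
   power of [log2 n]. *)
Lemma colorable_pow2 (k : nat) : exists C s0, forall s, s0 <= s ->
  exists g, colorable (2 ^ s) (3 + 6 * k) 3 (2 ^ g)
    /\ 2 ^ (s * (8 + k)) <= g ^ 4 * (s + 2) ^ C.
Proof.
elim: k => [|k [C [s0 IHk]]].
  (* The constant 24 comes from [4 * (2 * s - 6) + 24 = 8 * s]. *)
  exists 24, 4 => s le_s; exists (2 ^ (2 * s - 6)).
  split; first exact: colorable_base.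
  rewrite -expnM; apply: (@leq_trans (2 ^ ((2 * s - 6) * 4) * 2 ^ 24)).
    by rewrite -expnD leq_pexp2l //; lia.
  by rewrite leq_pmul2l ?expn_gt0 // leq_exp_base //; lia.
(* Passing from [s] to [s - r] costs [2 * (8 + k)], rounding [s / 4] down costs 3; the threshold
   ensures [s0 <= s - r] and [4 <= w]. *)
exists (C + (2 * (8 + k) + 3)), (2 * s0 + 16) => s le_s.
(* The step is taken with [l = 4 * w] and [m = 2 ^ (s - r)]: as [l <= s < 2 ^ r],
   [l * m < 2 ^ s]. *)
pose w := s %/ 4; pose t := trunc_log 2 s; pose r := t.+1.
have /andP[le_t lt_r] : 2 ^ t <= s < 2 ^ t.+1 by apply: trunc_log_bounds => //; lia.
have t_le := leq_double_exp2 t.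
have [g [col_g le_g]] : exists g, colorable (2 ^ (s - r)) (3 + 6 * k) 3 (2 ^ g)
    /\ 2 ^ ((s - r) * (8 + k)) <= g ^ 4 * (s - r + 2) ^ C.
  by apply: IHk; rewrite /r; lia.
have [|rho full] := @exists_pair_tricoloring w; first by rewrite /w; lia.
exists (g * 2 ^ w); split.
  rewrite (_ : 3 + 6 * k.+1 = 3 + 6 * k + 6); last by lia.
  rewrite expnM; apply: colorable_step col_g full _ _.
    have {2}-> : s = r + (s - r) by rewrite /r; lia.
    rewrite expnD ltn_pmul2r ?expn_gt0 //; apply: leq_ltn_trans lt_r.
    by rewrite /w; lia.
  by rewrite leq_pexp2l // /w; lia.
have le1 : 2 ^ (r * (8 + k)) <= (s + 2) ^ (2 * (8 + k)).
  by rewrite !expnM leq_exp_base // /r expnS; nia.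
have le2 : 2 ^ s <= (2 ^ w) ^ 4 * (s + 2) ^ 3.
  apply: (@leq_trans ((2 ^ w) ^ 4 * 2 ^ 3)).
    by rewrite -expnM -expnD leq_pexp2l // /w; lia.
  by rewrite leq_pmul2l ?expn_gt0 // leq_exp_base //; lia.
have le3 : 2 ^ ((s - r) * (8 + k)) <= g ^ 4 * (s + 2) ^ C.
  by apply: leq_trans le_g _; rewrite leq_mul2l leq_exp_base ?orbT //; lia.
have -> : s * (8 + k.+1) = (s - r) * (8 + k) + (r * (8 + k) + s).
  have : r * (8 + k) <= s * (8 + k) by rewrite leq_mul2r /r; lia.
  by rewrite mulnBl addnS mulnS; lia.
rewrite (expnD 2) (expnD 2 (r * _)) expnMn !(expnD (s + 2)).
apply: leq_trans (leq_mul le3 (leq_mul le1 le2)) _.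
by rewrite (mulnCA ((s + 2) ^ _)) mulnACA.
Qed.

(* From powers of two to the real exponent *)
From HB Require Import structures.
From mathcomp Require Import all_order all_algebra.
From mathcomp Require Import all_classical all_reals all_analysis.
From mathcomp Require Import lra.
Import Order.TTheory GRing.Theory Num.Theory.
Import numFieldNormedType.Exports.

Lemma is_max_colorable_ex (n q t : nat) : (1 < t)%N -> colorable n q t 0 ->
  exists N, is_max_colorable n q t N.
Proof.
move=> t_gt1 col0; have [B HB] := @colorable_bounded n q t t_gt1.
have exP : exists N, `[< colorable n q t N >] by exists 0%N; apply/asboolP.
have ubP N : `[< colorable n q t N >] -> (N <= B)%N by move=> /asboolP/HB.
case: (ex_maxnP exP ubP) => N /asboolP colN maxN; exists N; split=> // M colM.
by apply: maxN; apply/asboolP.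
Qed.

Lemma leq_triples_f (n q t N : nat) : (1 < t)%N -> colorable n q t N ->
  (N <= triples_f n q t)%N.
Proof.
move=> t_gt1 col; have [_] := xgetPex 0%N (is_max_colorable_ex t_gt1
  (colorable_le (leqnn n) (leqnn q) (leq0n N) col)).
exact.
Qed.

Lemma colorable_small (n q t N : nat) : (0 < q)%N -> (N < n)%N -> colorable n q t N.
Proof.
case: q => // q _ lt_Nn; exists (fun=> ord0) => S cS; exfalso.
by have := max_card (mem S); rewrite cS card_ord leqNgt lt_Nn.
Qed.

Local Open Scope classical_set_scope.
Local Open Scope ring_scope.

(** With [t = Num.sqrt (s + 2)], the logarithm is [2 * ln t <= 2 * t], so the left side grows at
    most like [t], the right side like [t ^+ 2]; [t > D] suffices. *)
Lemma ln_eventually_le_linear (R : realType) (A B e : R) :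
  0 <= A -> 0 <= B -> 0 < e ->
  exists s1 : nat, forall s : nat, (s1 <= s)%N ->
    A + B * ln (s + 2)%:R <= e * s%:R.
Proof.
move=> A0 B0 e0; pose D := (A + 2 * B + 2 * e) / e.
exists (Num.bound (D ^+ 2)) => s le_s.
have De : e * D = A + 2 * B + 2 * e by rewrite /D mulrC divfK // gt_eqF.
have D0 : 0 <= D by apply: divr_ge0; lra.
have : D ^+ 2 < s%:R + 2.
  apply: lt_le_trans (archi_boundP _) _; first exact: sqr_ge0.
  by apply: (@le_trans _ _ s%:R); rewrite ?ler_nat // lerDl.
set t := Num.sqrt (s%:R + 2 : R).
have st : s%:R + 2 = t ^+ 2 :> R by rewrite sqr_sqrtr // addr_ge0.
have t0 : 0 < t by rewrite sqrtr_gt0 ltr_wpDl.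
rewrite st => ltD; have {ltD} ltD : D < t.
  by rewrite -(@ltr_pXn2r _ 2) ?nnegrE // ltW.
have t1 : 1 <= t.
  rewrite -(@ler_pXn2r _ 2) ?nnegrE ?(ltW t0) //= expr1n -st.
  by have := ler0n R s; lra.
have lnt : ln (s + 2)%:R <= 2 * t :> R.
  by rewrite natrD st lnXn // mulr2n; have := ln_sublinear t0; lra.
have -> : s%:R = t ^+ 2 - 2 :> R by rewrite -st addrK.
have : B * ln (s + 2)%:R <= B * (2 * t) by rewrite ler_wpM2l.
have : e * D * t <= e * t * t by rewrite ler_pM2r // ler_pM2l // ltW.
have : 0 <= A * (t - 1) by rewrite mulr_ge0 // subr_ge0.
have : 0 <= e * (t - 1) by rewrite mulr_ge0 ?subr_ge0 // ltW.
by rewrite De expr2; lra.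
Qed.

(** Take logarithms, with [4 * a = 8 + k]: rounding [n] down to [2 ^ s] costs [a * ln 2], the power
    of [s + 2] at most the other term. The binary logarithm [ln f / ln 2] is at least [g]. *)
Lemma exponent_defect (R : realType) (k C n s g f : nat) :
  let a : R := 2 + 4^-1 * k%:R in
  (2 ^ s <= n < 2 ^ s.+1)%N -> (2 ^ g <= f)%N ->
  (2 ^ (s * (8 + k)) <= g ^ 4 * (s + 2) ^ C)%N ->
  a * ln n%:R - ln (ln f%:R / ln 2) <= a * ln 2 + C%:R * ln (s + 2)%:R :> R.
Proof.
move=> a /andP[le_n lt_n] le_f le_g.
have ln2 : 0 < ln 2 :> R by rewrite ln_gt0 // ltr1n.
have n_gt0 : (0 < n)%N by apply: leq_trans le_n; rewrite expn_gt0.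
have g_gt0 : (0 < g)%N.
  by case: g le_g {le_f} => //; rewrite exp0n // mul0n leqn0 expn_eq0.
have f_gt0 : (0 < f)%N by apply: leq_trans le_f; rewrite expn_gt0.
have lnn : ln n%:R <= ln 2 * s.+1%:R :> R.
  rewrite mulr_natr -lnXn // -natrX ler_ln ?posrE ?ltr0n ?expn_gt0 //.
  by rewrite ler_nat ltnW.
have lnf : ln g%:R <= ln (ln f%:R / ln 2) :> R.
  have gf : ln 2 * g%:R <= ln f%:R :> R.
    by rewrite mulr_natr -lnXn // -natrX ler_ln ?posrE ?ltr0n ?expn_gt0 // ler_nat.
  have g0 : 0 < g%:R :> R by rewrite ltr0n.
  have le1 : g%:R <= ln f%:R / ln 2 :> R by rewrite ler_pdivlMr // mulrC.
  by rewrite ler_ln ?posrE // (lt_le_trans g0).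
have lng : ln 2 * (s * (8 + k))%:R <= 4 * ln g%:R + C%:R * ln (s + 2)%:R :> R.
  rewrite mulr_natr !mulr_natl -!lnXn ?ltr0n ?addn_gt0 ?orbT //.
  rewrite -lnM ?posrE ?exprn_gt0 ?ltr0n ?addn_gt0 ?orbT // -!natrX -natrM.
  rewrite ler_ln ?posrE ?ltr0n ?muln_gt0 ?expn_gt0 ?g_gt0 ?addn_gt0 ?orbT //.
  by rewrite ler_nat.
have lns : 0 <= ln (s + 2)%:R :> R by rewrite ln_ge0 // ler1n addn_gt0 orbT.
have a0 : 0 <= a by rewrite addr_ge0 // mulr_ge0 // invr_ge0.
have : a * ln n%:R <= a * (ln 2 * s.+1%:R) by rewrite ler_wpM2l.
have : 0 <= C%:R * ln (s + 2)%:R :> R by rewrite mulr_ge0.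
move: lng lnf; rewrite natrM natrD -natr1 /a.
move: (ln _) (ln g%:R) (ln n%:R) (ln 2) => X Y Z W; nra.
Qed.

Theorem theorem3p4 (R : realType) (q : nat) (hq : (3 <= q)%N) :
  exists eps : nat -> R,
    eps @ \oo --> (0 : R) /\
    forall n : nat, (3 < n)%N ->
      (2 : R) `^ (n%:R `^ (2 + 4^-1 * ((q - 3) %/ 6)%N%:R - eps n))
        < (triples_f n q 3)%:R.
Proof.
set k := ((q - 3) %/ 6)%N; set a : R := 2 + _.
pose L (n : nat) : R := ln (ln (triples_f n q 3)%:R / ln 2).
(* The loss [a - L n / ln n] would give equality. The harmonic term makes the inequality strict for
   every [n > 3]; the maximum with 0 leaves only an upper bound to prove for the limit. *)
exists (fun n => Num.max 0 (a - L n / ln n%:R) + n.+1%:R^-1).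
have ln2 : 0 < ln 2 :> R by rewrite ln_gt0 // ltr1n.
split; last first.
  move=> n n_gt3; have lnn : 0 < ln n%:R :> R.
    by rewrite ln_gt0 // ltr1n ltnW // ltnW.
  have f3 : (3 <= triples_f n q 3)%N.
    by apply: leq_triples_f => //; apply: colorable_small => //; apply: leq_trans hq.
  have f0 : 0 < (triples_f n q 3)%:R :> R by rewrite ltr0n (leq_trans _ f3).
  have lnf : 0 < ln (triples_f n q 3)%:R :> R.
    by rewrite ln_gt0 // ltr1n (leq_trans _ f3).
  set e := Num.max _ _ + _.
  have lt_e : (a - e) * ln n%:R < L n.
    have inv0 : 0 < n.+1%:R^-1 :> R by rewrite invr_gt0 ltr0n.
    have : a - L n / ln n%:R <= Num.max 0 (a - L n / ln n%:R).
      by rewrite le_max lexx orbT.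
    rewrite -ltr_pdivlMr // /e; set m := Num.max _ _; set y := L n / _.
    by set z := _^-1 in inv0 *; lra.
  have n0 : (n%:R : R) != 0 by rewrite pnatr_eq0 -lt0n; apply: leq_trans n_gt3.
  have : n%:R `^ (a - e) < ln (triples_f n q 3)%:R / ln 2.
    rewrite /powR (negbTE n0) -[ltRHS]lnK ?posrE ?divr_gt0 //.
    by rewrite ltr_expR.
  rewrite ltr_pdivlMr // => lt_f.
  rewrite {1}/powR (negbTE (_ : 2 != 0 :> R)) ?pnatr_eq0 //.
  by rewrite -[ltRHS]lnK ?posrE // ltr_expR.
have [C [s0 Hcol]] := colorable_pow2 k.
rewrite -[0 in X in _ --> X]addr0; apply: cvgD; last first.
  exact: cvg_harmonic.
apply/cvgrPdist_le => e e0.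
have a0 : 0 <= a by rewrite addr_ge0 // mulr_ge0 // invr_ge0.
(* The factor [ln 2] is there because [ln 2 * s <= ln n] turns the bound into [e * ln n]. *)
have [s1 Hs1] := @ln_eventually_le_linear R (a * ln 2) C%:R (e * ln 2)
  (mulr_ge0 a0 (ltW ln2)) (ler0n _ _) (mulr_gt0 e0 ln2).
near=> n.
have n_ge : (2 ^ (s0 + s1 + 1) <= n)%N by near: n; exact: nbhs_infty_ge.
have n_gt0 : (0 < n)%N by apply: leq_trans n_ge; rewrite expn_gt0.
rewrite sub0r normrN ger0_norm ?le_max ?lexx // ge_max ltW //=.
set s := trunc_log 2 n.
have s_ge : (s0 + s1 + 1 <= s)%N by apply: trunc_log_max.
have s_bounds : (2 ^ s <= n < 2 ^ s.+1)%N by apply: trunc_log_bounds.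
have [|g [colg le_g]] := Hcol s; first by lia.
have le_f : (2 ^ g <= triples_f n q 3)%N.
  apply: leq_triples_f => //; apply: colorable_le colg => //; last first.
    by rewrite /k; lia.
  by case/andP: s_bounds.
have := exponent_defect R s_bounds le_f le_g; rewrite -/a -/(L n) => defect.
have lin := Hs1 s ltac:(lia).
have lns : ln 2 * s%:R <= ln n%:R :> R.
  rewrite mulr_natr -lnXn // -natrX ler_ln ?posrE ?ltr0n ?expn_gt0 // ler_nat.
  by case/andP: s_bounds.
have lnn : 0 < ln n%:R :> R.
  by apply: lt_le_trans lns; rewrite mulr_gt0 // ltr0n; lia.
rewrite lerBlDl -lerBlDr ler_pdivlMr // mulrBl.
have : e * (ln 2 * s%:R) <= e * ln n%:R by rewrite ler_wpM2l // ltW.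
lra.
Unshelve. all: by end_near.
Qed.
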